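(* Let $P$ be a NPP and let $\mathcal{G}$ be a valid abstraction of $P$ relative to $F$ for the abstract domain $D^\sharp$. Then \begin{align*} \mathrm{Reach}(\mathcal{M}_P, F)^{-} &\in [\mathrm{Reach}(\mathcal{G}, \{\odot, \otimes\})^{--}, \mathrm{Reach}(\mathcal{G}, \{\odot, \otimes\})^{-+}] \text{ and } \\ \mathrm{Reach}(\mathcal{M}_P, F)^{+} &\in [\mathrm{Reach}(\mathcal{G}, \{\odot\})^{+-}, \mathrm{Reach}(\mathcal{G}, \{\odot\})^{++}]. \end{align*}
   Context: A NPP is $P=(\mathcal{V},\sigma_0,\mathcal{C})$: finitely many variables, initial configuration $\sigma_0\in\Sigma_\mathcal{V}$, and finitely many guarded commands $A = g_A \rightarrow p_1:c_1+\dots+p_m:c_m$ (guard $g_A$, probabilities summing to 1, assignments $c_i$; $up_A=\{\langle p_i,c_i\rangle\}$). Its MDP $\mathcal{M}_P$ has player-1 nodes $\Sigma_\mathcal{V}$, probabilistic nodes $\Sigma_\mathcal{V}\times\mathcal{C}$, edges $\sigma\rightarrow\langle\sigma,A\rangle$ iff $\sigma$ enables $g_A$, and $\delta(\langle\sigma,A\rangle)(\sigma')=\sum_{\langle p,c\rangle\in up_A:\,[\![c]\!](\sigma)=\sigma'}p$. $F\subseteq\Sigma_\mathcal{V}$ is a set of final states with $\sigma_0\notin F$; it is assumed every reachable non-final configuration enables some guard. $D^\sharp$ is a complete lattice with monotone abstraction/concretization maps $\alpha,\gamma$ forming a Galois connection with $2^{\Sigma_\mathcal{V}}$. For a stochastic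 2-player game $\mathcal{G}=((V_1,V_2,V_p),E,\delta,s_0)$, strategies $\phi_1,\phi_2$ and target $T\subseteq V_1$, $\mathrm{Reach}(\mathcal{G}[\phi_1,\phi_2],T)$ is the sum of the values (probabilities) of the finite runs that end in $T$ and visit $T$ for the first time at their end. The extremal values are $\mathrm{Reach}(\mathcal{G},T)^{++}=\sup_{\phi_1}\sup_{\phi_2}$, $^{+-}=\sup_{\phi_1}\inf_{\phi_2}$, $^{-+}=\inf_{\phi_1}\sup_{\phi_2}$, $^{--}=\inf_{\phi_1}\inf_{\phi_2}$ of $\mathrm{Reach}(\mathcal{G}[\phi_1,\phi_2],T)$. For an MDP $\mathcal{M}$ (no Player 2), $\mathrm{Reach}(\mathcal{M},F)^{+}$ and $\mathrm{Reach}(\mathcal{M},F)^{-}$ are the sup and inf over Player-1 strategies. A game $\mathcal{G}=((V_1,V_2,V_p),E,\delta,s_0)$ with finitely many nodes is a valid abstraction of $P$ relative to $F$ for $D^\sharp$ if: $V_1$ contains a subset of $D^\sharp$ plus two distinguished sink states, written $\odot$ (''accept'') and $\otimes$ (''reject''); $V_2$ consists of pairs $\langle s,A\rangle$ with $s\in V_1\setminus\{\odot,\otimes\}$ and either $A=\odot$ or $A\in\mathcal{C}$ enabled by some state of $\gamma(s)$; $V_p$ consists of tuples $\langle s,A,s',d\rangle$ with $s,s'\in V_1\setminus\{\odot,\otimes\}$, $s\sqsupseteq s'$, $A$ enabled by some state of $\gamma(s')$, and $d$ assigning to each $\langle p,c\rangle\in up_A$ an abstract state in $V_1$ with $\gamma(d(\langle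 p,c\rangle))\supseteq c(\gamma(s'))$; $s_0=\alpha(\{\sigma_0\})$; and (1) for $s\in V_1\setminus\{\odot,\otimes\}$, $A\in\mathcal{C}$: (a) if $\gamma(s)\cap F\neq\emptyset$ then $s\rightarrow\langle s,\odot\rangle\rightarrow\odot$, and if moreover $\gamma(s)\subseteq F$ then $\langle s,\odot\rangle$ is the only successor of $s$, otherwise also $\langle s,\odot\rangle\rightarrow\langle s,\odot\rangle$; (b) if $g_A(\gamma(s))\neq\emptyset$ then $\langle s,A\rangle\in V_2$ and $s\rightarrow\langle s,A\rangle$; (2) for every $\langle s,A\rangle\in V_2$ with $A\in\mathcal{C}$: (a) there are nodes $\langle s,A,s_i,d_i\rangle\in V_p$, $i\le k$, with $\langle s,A\rangle\rightarrow\langle s,A,s_i,d_i\rangle$ and $g_A(\gamma(s))\subseteq\bigcup_j\gamma(s_j)$; (b) if $\gamma(s)\cap F\neq\emptyset$ then $\langle s,A\rangle\rightarrow\odot$; (c) if $g_A(\gamma(s))\neq\gamma(s)$ then $\langle s,A\rangle\rightarrow\otimes$; (3) $\delta(\langle s,A,s',d\rangle)(s'')=\sum_{\langle p,c\rangle\in up_A:\,d(\langle p,c\rangle)=s''}p$; (4) $\odot$ and $\otimes$ have no outgoing edges.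
   Formalization: A valid abstraction is also required to give an abstract state s no successors besides the ⟨s,A⟩ and, only if γ(s) meets F, ⟨s,⊙⟩ (otherwise the claim fails); (1b) is required only when γ(s) is not contained in F, since (1a) then fixes the only successor. *)

(* Defs.v *)
From HB Require Import structures.
From mathcomp Require Import all_boot all_order all_algebra.
From mathcomp Require Import all_classical all_reals all_analysis.

Set Implicit Arguments.
Unset Strict Implicit.
Unset Printing Implicit Defensive.

Import Order.TTheory GRing.Theory Num.Theory.

Local Open Scope classical_set_scope.
Local Open Scope ring_scope.

Inductive node (T1 T2 Tp : Type) : Type :=
  | N1 of T1
  | N2 of T2
  | Np of Tp.
Arguments N1 {T1 T2 Tp}.
Arguments N2 {T1 T2 Tp}.
Arguments Np {T1 T2 Tp}.

HB.instance Definition _ (T1 T2 Tp : Type) := gen_eqMixin (node T1 T2 Tp).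
HB.instance Definition _ (T1 T2 Tp : Type) := gen_choiceMixin (node T1 T2 Tp).

Definition is_dist (R : realType) (T : choiceType) (f : T -> R) : Prop :=
  (forall x, 0 <= f x) /\ (\esum_(x in [set: T]) (f x)%:E = 1)%E.

Definition in_nodes (T1 T2 Tp : Type) (V1 : set T1) (V2 : set T2) (Vp : set Tp)
    (x : node T1 T2 Tp) : Prop :=
  match x with N1 a => V1 a | N2 b => V2 b | Np u => Vp u end.

Definition is_prob (T1 T2 Tp : Type) (x : node T1 T2 Tp) : Prop :=
  if x is Np _ then True else False.

(* The three node sets are subsets of ambient types; [node] makes them
   disjoint.  The value of [delta] outside [Vp] is irrelevant. *)
Record game (R : realType) (T1 T2 Tp : Type) : Type := Game {
  V1 : set T1;
  V2 : set T2;
  Vp : set Tp;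
  edge : node T1 T2 Tp -> node T1 T2 Tp -> Prop;
  delta : Tp -> node T1 T2 Tp -> R;
  s0 : T1;
  edge_nodes : forall v x, edge v x ->
    [/\ in_nodes V1 V2 Vp v, ~ is_prob v & in_nodes V1 V2 Vp x];
  delta_dist : forall u, Vp u ->
    is_dist (delta u) /\ (forall x, 0 < delta u x -> in_nodes V1 V2 Vp x);
  s0_V1 : V1 s0
}.

Inductive player := P1 | P2.

Section Games.
Variables (R : realType) (T1 T2 Tp : Type) (G : game R T1 T2 Tp).
Notation node := (node T1 T2 Tp).

Definition owns (i : player) (v : node) : Prop :=
  match i, v with
  | P1, N1 _ | P2, N2 _ => True
  | _, _ => False
  end.

Definition succ (v x : node) : Prop :=
  if v is Np u then 0 < delta G u x else edge G v x.

(* Runs are listed most recent node first: the head is the current node and the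
   last element is the initial node. *)
Inductive run : seq node -> Prop :=
  | run_init : run [:: N1 (s0 G)]
  | run_step v w x : run (v :: w) -> succ v x -> run (x :: v :: w).

(* Strategies are randomized and history dependent.  They are partial functions
   on runs; the values outside the domain (non-runs, runs ending in a node of
   the other kind, runs ending in a node without successor) are unconstrained
   and never used by [reach]. *)
Definition strategies (i : player) : set (seq node -> node -> R) :=
  [set phi | forall v w, run (v :: w) -> owns i v -> (exists x, edge G v x) ->
    is_dist (phi (v :: w)) /\ (forall x, 0 < phi (v :: w) x -> edge G v x)].

Definition step_prob (phi1 phi2 : seq node -> node -> R)
    (v : node) (w : seq node) (x : node) : R :=
  match v with
  | N1 _ => phi1 (v :: w) x
  | N2 _ => phi2 (v :: w) x
  | Np u => delta G u x
  end.

Fixpoint run_val (phi1 phi2 : seq node -> node -> R) (r : seq node) : R :=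
  match r with
  | x :: ((v :: w) as r') => run_val phi1 phi2 r' * step_prob phi1 phi2 v w x
  | _ => 1
  end.

Definition in_target (T : set T1) (x : node) : Prop :=
  if x is N1 a then T a else False.

Definition first_hit (T : set T1) : set (seq node) :=
  [set r | run r /\ exists x w,
    [/\ r = x :: w, in_target T x & forall y, y \in w -> ~ in_target T y]].

Definition reach (phi1 phi2 : seq node -> node -> R) (T : set T1) : \bar R :=
  (\esum_(r in first_hit T) (run_val phi1 phi2 r)%:E)%E.

Definition reach_pp (T : set T1) : \bar R :=
  ereal_sup [set ereal_sup [set reach phi1 phi2 T | phi2 in strategies P2]
            | phi1 in strategies P1].
Definition reach_pm (T : set T1) : \bar R :=
  ereal_sup [set ereal_inf [set reach phi1 phi2 T | phi2 in strategies P2]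
            | phi1 in strategies P1].
Definition reach_mp (T : set T1) : \bar R :=
  ereal_inf [set ereal_sup [set reach phi1 phi2 T | phi2 in strategies P2]
            | phi1 in strategies P1].
Definition reach_mm (T : set T1) : \bar R :=
  ereal_inf [set ereal_inf [set reach phi1 phi2 T | phi2 in strategies P2]
            | phi1 in strategies P1].

End Games.

Definition mdp (R : realType) (T1 Tp : Type) : Type := game R T1 void Tp.

(* There is no Player 2 node, so the second strategy is never consulted. *)
Definition mdp_reach (R : realType) (T1 Tp : Type) (M : mdp R T1 Tp)
    (phi1 : seq (node T1 void Tp) -> node T1 void Tp -> R) (T : set T1) :=
  reach M phi1 (fun _ _ => 0) T.

Definition mdp_reach_p (R : realType) (T1 Tp : Type) (M : mdp R T1 Tp)
    (T : set T1) : \bar R :=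
  ereal_sup [set mdp_reach M phi1 T | phi1 in strategies M P1].
Definition mdp_reach_m (R : realType) (T1 Tp : Type) (M : mdp R T1 Tp)
    (T : set T1) : \bar R :=
  ereal_inf [set mdp_reach M phi1 T | phi1 in strategies M P1].

(* Commands are named by the finite type [cmd].  The updates of a command are an
   indexed family rather than a set of pairs, so that equal summands such as
   1/2:c + 1/2:c keep their total weight. *)
Record npp (R : realType) : Type := NPP {
  var : finType;
  rng : var -> Type;
  init : forall x : var, rng x;
  cmd : finType;
  guard : cmd -> set (forall x : var, rng x);
  arity : cmd -> nat;
  prob : forall A : cmd, 'I_(arity A) -> R;
  asgn : forall A : cmd, 'I_(arity A) ->
           (forall x : var, rng x) -> (forall x : var, rng x);
  prob_ge0 : forall (A : cmd) (i : 'I_(arity A)), 0 <= prob i;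
  prob_sum1 : forall A : cmd, \sum_(i < arity A) prob i = 1
}.

Definition config (R : realType) (P : npp R) : Type :=
  forall x : var P, rng x.

Section ProgramMDP.
Variables (R : realType) (P : npp R).
Let nodeP := node (config P) void (config P * cmd P)%type.

Definition prog_edge (v x : nodeP) : Prop :=
  exists sigma A, [/\ v = N1 sigma, x = Np (sigma, A) & guard A sigma].

Definition prog_delta (u : config P * cmd P) (x : nodeP) : R :=
  if x is N1 sigma' then
    \sum_(i < arity u.2 | `[< asgn i u.1 = sigma' >]) prob i
  else 0.

Lemma prog_edge_nodes (v x : nodeP) : prog_edge v x ->
  [/\ in_nodes setT set0 setT v, ~ is_prob v & in_nodes setT set0 setT x].
Proof. by move=> [sigma [A [-> -> _]]]; split. Qed.

Lemma prog_delta_dist (u : config P * cmd P) : setT u ->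
  is_dist (prog_delta u) /\
  (forall x, 0 < prog_delta u x -> in_nodes setT set0 setT x).
Proof.
move=> _; split; last by case=> [//|[]|//].
split=> [[sigma|[]|p] /=|]; first by apply: sumr_ge0 => i _; exact: prob_ge0.
- exact: lexx.
pose a (x : nodeP) (i : 'I_(arity u.2)) : \bar R :=
  (if x \in [set N1 (asgn i u.1) : nodeP] then (prob i)%:E else 0)%E.
have aE x : (prog_delta u x)%:E = (\sum_(i < arity u.2) a x i)%E.
  case: x => [sigma|[]|p] /=.
    rewrite -sumEFin big_mkcond /=; apply: eq_bigr => i _; rewrite /a.
    case: asboolP => [->|ne]; first by rewrite mem_set.
    by rewrite memNset // => -[] e; apply: ne.
  by rewrite big1 // => i _; rewrite /a memNset.
under eq_esum do rewrite aE.
rewrite esum_sum => [|x i _ _]; last first.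
  by rewrite /a; case: ifP => // _; rewrite lee_fin prob_ge0.
transitivity (\sum_(i < arity u.2) (prob i)%:E)%E; last first.
  by rewrite sumEFin prob_sum1.
apply: eq_bigr => i _; rewrite /a.
rewrite -(esum_mkcondr setT) setTI esum_set1 //.
by rewrite lee_fin prob_ge0.
Qed.

Definition prog_mdp : mdp R (config P) (config P * cmd P)%type :=
  Game prog_edge_nodes prog_delta_dist (I : [set: config P] (@init R P)).

Definition reachable (sigma : config P) : Prop :=
  exists w, run prog_mdp (N1 sigma :: w).

End ProgramMDP.

Definition complete_lattice (disp : Order.disp_t) (D : porderType disp) : Prop :=
  forall S : set D, supremums S !=set0.

Record galois_connection (disp : Order.disp_t) (D : porderType disp)
    (Sigma : Type) (alpha : set Sigma -> D) (gamma : D -> set Sigma) : Prop := {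
  alpha_mono : forall X Y, X `<=` Y -> (alpha X <= alpha Y)%O;
  gamma_mono : forall s t, (s <= t)%O -> gamma s `<=` gamma t;
  alpha_gamma : forall X s, (alpha X <= s)%O <-> X `<=` gamma s
}.

Inductive abs1 (D : Type) : Type :=
  | Abs of D
  | Accept
  | Reject.
Arguments Abs {D}.
Arguments Accept {D}.
Arguments Reject {D}.

(* [(s, None)] is the pair of s and the accept symbol. *)
Definition abs2 (R : realType) (P : npp R) (D : Type) : Type :=
  (D * option (cmd P))%type.

Record absp (R : realType) (P : npp R) (D : Type) : Type := Absp {
  p_src : D;
  p_cmd : cmd P;
  p_sub : D;
  p_dst : 'I_(arity p_cmd) -> D
}.
Arguments Absp {R P D}.

Definition abs_game (R : realType) (P : npp R) (D : Type) : Type :=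
  game R (abs1 D) (abs2 P D) (absp P D).

(* [va_edge1] makes explicit that a Player 1 node has no successors other than
   the ones the definition introduces; without it Player 1 could be given
   arbitrary moves, e.g. directly to [Accept].  Player 2 nodes may have edges
   beyond the required ones.
   In [va_1b] the case gamma s `<=` F is left out because there [va_1a]
   prescribes (s, None) as the only successor of s. *)
Record valid_abstraction (R : realType) (P : npp R) (F : set (config P))
    (disp : Order.disp_t) (D : porderType disp)
    (alpha : set (config P) -> D) (gamma : D -> set (config P))
    (G : abs_game P D) : Prop := {
  va_finite : [/\ finite_set (V1 G), finite_set (V2 G) & finite_set (Vp G)];
  va_sinks : V1 G Accept /\ V1 G Reject;
  va_V2 : forall s o, V2 G (s, o) ->
    V1 G (Abs s) /\
    (if o is Some A then gamma s `&` guard A !=set0 else True);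
  va_Vp : forall s A s' d, Vp G (Absp s A s' d) ->
    [/\ V1 G (Abs s), V1 G (Abs s'), (s' <= s)%O,
        gamma s' `&` guard A !=set0 &
        forall i, V1 G (Abs (d i)) /\ asgn i @` gamma s' `<=` gamma (d i)];
  va_s0 : s0 G = Abs (alpha [set @init R P]);
  va_edge1 : forall s x, edge G (N1 (Abs s)) x ->
    (exists A, x = N2 (s, Some A)) \/
    (x = N2 (s, None) /\ gamma s `&` F !=set0);
  va_1a : forall s, V1 G (Abs s) -> gamma s `&` F !=set0 ->
    [/\ edge G (N1 (Abs s)) (N2 (s, None)),
        edge G (N2 (s, None)) (N1 Accept),
        gamma s `<=` F ->
          forall x, edge G (N1 (Abs s)) x -> x = N2 (s, None) &
        ~ (gamma s `<=` F) -> edge G (N2 (s, None)) (N2 (s, None))];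
  va_1b : forall s A, V1 G (Abs s) -> ~ (gamma s `<=` F) ->
    gamma s `&` guard A !=set0 ->
    V2 G (s, Some A) /\ edge G (N1 (Abs s)) (N2 (s, Some A));
  va_2a : forall s A, V2 G (s, Some A) ->
    exists (k : nat) (t : 'I_k -> D) (d : 'I_k -> 'I_(arity A) -> D),
      (forall j, Vp G (Absp s A (t j) (d j)) /\
                 edge G (N2 (s, Some A)) (Np (Absp s A (t j) (d j)))) /\
      gamma s `&` guard A `<=` \bigcup_j gamma (t j);
  va_2b : forall s A, V2 G (s, Some A) -> gamma s `&` F !=set0 ->
    edge G (N2 (s, Some A)) (N1 Accept);
  va_2c : forall s A, V2 G (s, Some A) -> gamma s `&` guard A <> gamma s ->
    edge G (N2 (s, Some A)) (N1 Reject);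
  va_3 : forall s A s' d, Vp G (Absp s A s' d) -> forall t, V1 G t ->
    delta G (Absp s A s' d) (N1 t) =
      \sum_(i < arity A | `[< Abs (d i) = t >]) prob i;
  va_4 : forall x, ~ edge G (N1 Accept) x /\ ~ edge G (N1 Reject) x
}.

(* Main.v *)
(* The extremal reachability values of a finitely branching game are the limits
   of value iteration from 0.  A minimizer attains the limit with a memoryless
   choice (finitely many successors, so one of them stays below the limit at
   every stage), and a maximizer attains the n-th iterate by playing a stagewise
   optimal successor for n steps.  This removes the mismatch between abstract
   and concrete histories: it suffices to compare the iterates of the abstract
   game at [s] with those of the program MDP at each [sigma] in [gamma s], by
   induction on the stage.  In the abstract game Player 2 can follow the
   concrete step of [sigma] whenever Player 1 selects a command enabled in
   [sigma], and otherwise escapes to a sink (or loops) with the required value.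
   One concrete round takes 2 moves in the MDP and 3 in the abstract game. *)

Require Import Defs.
From mathcomp Require Import all_boot all_order all_algebra.
From mathcomp Require Import finmap.
From mathcomp Require Import all_classical all_reals all_analysis.

Set Implicit Arguments.
Unset Strict Implicit.
Unset Printing Implicit Defensive.

Import Order.TTheory GRing.Theory Num.Theory.

Local Open Scope classical_set_scope.
Local Open Scope ring_scope.

(** * Sums over sets *)

Section ExtendedSums.
Context {R : realType} {T : choiceType}.
Implicit Types (S : set T) (f : T -> \bar R) (p : T -> R).
Local Open Scope ereal_scope.

(** Finite partial sums give [<=]. The reverse inequality is the same bound for the factor [r^-1],
    so the case [r = 0] is split off first. *)
Lemma ge0_esumZl S (r : R) f : (0 <= r)%R -> (forall x, S x -> 0 <= f x) ->
  \esum_(x in S) (r%:E * f x) = r%:E * \esum_(x in S) f x.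
Proof.
have leZ (s : R) g : (0 <= s)%R -> (forall x, S x -> 0 <= g x) ->
    \esum_(x in S) (s%:E * g x) <= s%:E * \esum_(x in S) g x.
  move=> s0 g0; apply: ge_ereal_sup => _ [X [finX XS] <-].
  rewrite fsbig_finite//= big_seq -ge0_sume_distrr; last first.
    by move=> x; rewrite in_fset_set// inE => /XS; exact: g0.
  rewrite lee_wpmul2l// -big_seq -fsbig_finite//.
  by apply: ereal_sup_ubound; exists X.
rewrite le_eqVlt => /orP[/eqP <-|r0] f0.
  by rewrite mul0e esum1// => x _; rewrite mul0e.
apply/eqP; rewrite eq_le leZ//= ?(ltW r0)//.
rewrite -[leRHS]mul1e -(divff (lt0r_neq0 r0)) EFinM -muleA lee_wpmul2l//.
  by rewrite lee_fin ltW.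
apply: le_trans (leZ _ _ _ _).
- rewrite le_eqVlt; apply/orP; left; apply/eqP/eq_esum => x Sx.
  by rewrite muleA -EFinM mulVf ?mul1e// lt0r_neq0.
- by rewrite invr_ge0 ltW.
- by move=> x Sx; rewrite mule_ge0 ?lee_fin ?(ltW r0)// f0.
Qed.

Lemma le_esum_subset S S' f : S `<=` S' -> (forall x, S' x -> 0 <= f x) ->
  \esum_(x in S) f x <= \esum_(x in S') f x.
Proof.
move=> SS' f0; apply: ge_ereal_sup => _ [X [finX XS] <-].
by apply: ereal_sup_ubound; exists X => //; split => // x /XS /SS'.
Qed.

(** Limits of nondecreasing sequences commute with a finite partial sum, each stage of which is at
    most [c]. *)
Lemma esum_monotone_convergence_le S p (f : nat -> T -> \bar R) c :
  (forall x, S x -> (0 <= p x)%R) -> (forall n x, 0 <= f n x) ->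
  (forall x, nondecreasing_seq (f ^~ x)) ->
  (forall n, \esum_(x in S) ((p x)%:E * f n x) <= c) ->
  \esum_(x in S) ((p x)%:E * ereal_sup (range (f ^~ x))) <= c.
Proof.
move=> p0 f0 fnd fc; apply: ge_ereal_sup => _ [X [finX XS] <-].
rewrite fsbig_finite//= big_seq.
suff : \sum_(x <- fset_set X | x \in fset_set X) ((p x)%:E * f n x) @[n --> \oo]
    --> \sum_(x <- fset_set X | x \in fset_set X)
          ((p x)%:E * ereal_sup (range (f ^~ x))).
  apply: cvge_le; apply: nearW => n; rewrite -big_seq -fsbig_finite//=.
  by apply: le_trans (fc n); apply: ereal_sup_ubound; exists X.
apply: cvg_nnesum => x; rewrite in_fset_set// inE => /XS Sx.
  by apply: nearW => n; rewrite mule_ge0 ?lee_fin ?p0.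
by apply: cvgeZl => //; exact: ereal_nondecreasing_cvgn.
Qed.

Lemma is_dist_esum p S : is_dist p -> (forall x, (0 < p x)%R -> S x) ->
  \esum_(x in S) (p x)%:E = 1.
Proof.
move=> [p0 p1] pS; rewrite esum_mkcond -[RHS]p1; apply: eq_esum => x _.
case: ifPn => // /negP xS; congr (_%:E); apply/eqP; rewrite eq_le p0 /=.
by rewrite leNgt; apply/negP => /pS Sx; apply: xS; rewrite inE.
Qed.

Definition dirac_fun (y x : T) : R := (x == y)%:R.

Lemma esum_dirac_fun S y f : S y -> 0 <= f y ->
  \esum_(x in S) ((dirac_fun y x)%:E * f x) = f y.
Proof.
move=> Sy fy; transitivity (\esum_(x in S `&` [set y]) f x).
  rewrite esum_mkcondr; apply: eq_esum => x _; rewrite /dirac_fun.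
  case: eqVneq => [->|/eqP xy]; first by rewrite mem_set ?mul1e.
  by rewrite memNset ?mul0e.
by rewrite (_ : _ `&` _ = [set y]) ?esum_set1//; apply/seteqP; split=> x [] //= ->.
Qed.

Lemma is_dist_dirac_fun y : is_dist (dirac_fun y).
Proof.
split=> [x|]; first by rewrite /dirac_fun ler0n.
rewrite -[RHS](@esum_dirac_fun setT y (cst 1))//.
by apply: eq_esum => x _; rewrite mule1.
Qed.

Lemma dirac_fun_gt0 y x : (0 < dirac_fun y x)%R -> x = y.
Proof. by rewrite /dirac_fun; case: eqVneq => //= _; rewrite ltxx. Qed.

(** The map [q] may send several indices to one point; writing the weight of a point as a sum over
    [i] and exchanging the two sums separates them again. *)
Lemma esum_finsupp k (p : 'I_k -> R) (q : 'I_k -> T) f :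
  (forall i, (0 <= p i)%R) -> (forall x, 0 <= f x) ->
  \esum_(x in [set: T]) ((\sum_(i < k | `[< q i = x >]) p i)%:E * f x) =
  \sum_(i < k) (p i)%:E * f (q i).
Proof.
move=> p0 f0; pose a x i := if x \in [set q i] then (p i)%:E * f x else 0.
transitivity (\esum_(x in [set: T]) \sum_(i < k) a x i).
  apply: eq_esum => x _.
  rewrite -sumEFin ge0_sume_distrl => [|i _]; last by rewrite lee_fin.
  rewrite big_mkcond; apply: eq_bigr => i _; rewrite /a.
  by case: asboolP => [->|qx]; [rewrite mem_set|rewrite memNset // => /esym].
rewrite esum_sum => [|x i _ _]; last first.
  by rewrite /a; case: ifP => // _; rewrite mule_ge0 ?lee_fin.
apply: eq_bigr => i _; rewrite /a -(esum_mkcondr setT) setTI esum_set1//.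
by rewrite mule_ge0 ?lee_fin.
Qed.

Lemma is_dist_finsupp k (p : 'I_k -> R) (q : 'I_k -> T) :
  (forall i, (0 <= p i)%R) -> (\sum_(i < k) p i = 1)%R ->
  is_dist (fun x => \sum_(i < k | `[< q i = x >]) p i)%R.
Proof.
move=> p0 p1; split=> [x|]; first exact: sumr_ge0.
under eq_esum do rewrite -[_%:E]mule1.
rewrite (@esum_finsupp k p q (cst 1))//; under eq_bigr do rewrite mule1.
by rewrite sumEFin p1.
Qed.

(** A strict excess of [q] over [p] at one point would make the mass of [q] exceed 1. *)
Lemma is_dist_eq p (q : T -> R) : is_dist p -> is_dist q ->
  (forall x, (p x <= q x)%R) -> p =1 q.
Proof.
move=> [p0 p1] [q0 q1] pq x; apply/eqP; rewrite eq_le pq /= leNgt; apply/negP => lt.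
have : 1 + (q x - p x)%:E <= 1 :> \bar R.
  rewrite -{1}p1 -q1 -(@esum_set1 _ _ x (fun y => (q y - p y)%:E)) ?lee_fin ?subr_ge0//.
  rewrite (esum_mkcond [set x]) -esumD => [|y _|y _]; last 2 first.
  - by rewrite lee_fin.
  - by case: ifP => // _; rewrite lee_fin subr_ge0.
  apply: le_esum => y _; case: ifPn; rewrite ?adde0 -?EFinD lee_fin// => _.
  by rewrite addrC subrK.
by rewrite -EFinD lee_fin gerDl leNgt subr_gt0 lt.
Qed.

Lemma finite_arg_max S f : finite_set S -> S !=set0 ->
  exists2 x, S x & forall y, S y -> f y <= f x.
Proof.
move=> /finite_seqP[s ->]; elim: s => [[]//|a s IH] _.
case: s IH => [_|b s IH].
  by exists a => [|y]; rewrite /= mem_seq1 ?eqxx// => /eqP ->.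
have [|x sx xmax] := IH; first by exists b; rewrite /= mem_head.
have [ax|/ltW xa] := leP (f a) (f x).
  exists x; first by rewrite /= in_cons; move: sx => /= ->; rewrite orbT.
  by move=> y /=; rewrite in_cons => /orP[/eqP ->//|/xmax].
exists a; first by rewrite /= mem_head.
by move=> y /=; rewrite in_cons => /orP[/eqP ->//|/xmax /le_trans]; apply.
Qed.

(** Otherwise each point of [S] exceeds [c] at some stage, and by monotonicity all of them exceed
    [c] at the largest of these finitely many stages. *)
Lemma finite_uniform_bound S (f : nat -> T -> \bar R) c : finite_set S ->
  (forall x, nondecreasing_seq (f ^~ x)) ->
  (forall n, exists2 x, S x & f n x <= c) ->
  exists2 x, S x & forall n, f n x <= c.
Proof.
move=> /finite_seqP[s ->] fnd small; apply: contrapT => none.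
suff [N big] : exists N, forall x, x \in s -> c < f N x.
  by have [x /big] := small N; rewrite ltNge => /negbTE ->.
have: forall x, x \in s -> exists n, c < f n x.
  move=> x xs; apply: contrapT => nbig; apply: none; exists x => // n.
  by rewrite leNgt; apply/negP => cf; apply: nbig; exists n.
elim: (s) => [_|a t IH big]; first by exists 0%N.
have [|N tN] := IH; first by move=> x xt; apply: big; rewrite in_cons xt orbT.
have [k ak] := big a (mem_head _ _).
exists (maxn N k) => x; rewrite in_cons => /orP[/eqP ->|/tN xN].
  by apply: lt_le_trans ak _; apply: fnd; rewrite leq_maxr.
by apply: lt_le_trans xN _; apply: fnd; rewrite leq_maxl.
Qed.

End ExtendedSums.

(** * Finite-horizon reachability *)

Section Runs.
Variables (R : realType) (T1 T2 Tp : Type) (G : game R T1 T2 Tp).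
Notation node := (node T1 T2 Tp).
Implicit Types (v x : node) (w : seq node).

(** Used both for pairs of strategies and for objectives [player -> bool], so that arguments about
    either player are given once, for a player [i]. *)
Definition pchoose A (a1 a2 : A) (i : player) : A := if i is P1 then a1 else a2.

Lemma succ_edge i v x : owns i v -> succ G v x = edge G v x.
Proof. by case: i v => -[]. Qed.

Lemma owned_or_prob v : (exists i, owns i v) \/ (exists u, v = Np u).
Proof. by case: v => u; [left; exists P1|left; exists P2|right; exists u]. Qed.

Lemma succ_in_nodes v x : in_nodes (V1 G) (V2 G) (Vp G) v -> succ G v x ->
  in_nodes (V1 G) (V2 G) (Vp G) x.
Proof.
case: v => [a _|b _|u Vu]; [by case/edge_nodes..|].
by have [_] := delta_dist Vu; apply.
Qed.

Lemma run_in_nodes v w : run G (v :: w) -> in_nodes (V1 G) (V2 G) (Vp G) v.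
Proof.
suff H r : run G r -> forall v w, r = v :: w -> in_nodes (V1 G) (V2 G) (Vp G) v.
  by move=> /H; apply.
elim=> [|y w' x _ IH yx] {}v {}w [<- _]; first exact: s0_V1.
by apply: succ_in_nodes yx; exact: IH.
Qed.

Lemma run_cat u v w : run G (u ++ v :: w) -> run G (v :: w).
Proof. by elim: u => // a [|b u] IH r; apply: IH; inversion r. Qed.

Lemma run_last r : run G r -> exists u, r = u ++ [:: N1 (s0 G)].
Proof.
elim=> [|v w x _ [u ->] _]; first by exists [::].
by exists (x :: u).
Qed.

Section StrategyPair.
Variables phi1 phi2 : seq node -> node -> R.
Hypothesis S1 : strategies G P1 phi1.
Hypothesis S2 : strategies G P2 phi2.
Notation sp := (step_prob G phi1 phi2).

Lemma step_prob_owned i v w : owns i v -> sp v w = pchoose phi1 phi2 i (v :: w).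
Proof. by case: i v => -[]. Qed.

Lemma strategy_pair i : strategies G i (pchoose phi1 phi2 i).
Proof. by case: i. Qed.

Lemma step_prob_dist v w : run G (v :: w) -> succ G v !=set0 ->
  is_dist (sp v w) /\ (forall x, 0 < sp v w x -> succ G v x).
Proof.
move=> r [x vx]; have [[i iv]|[u vE]] := owned_or_prob v.
  have [] := strategy_pair r iv; first by exists x; rewrite -(succ_edge _ iv).
  rewrite (step_prob_owned w iv) => ds sup; split => // y /sup.
  by rewrite (succ_edge _ iv).
have := run_in_nodes r; rewrite vE => Vu; split => //.
by have [] := delta_dist Vu.
Qed.

Lemma step_prob_ge0 v w x : run G (v :: w) -> succ G v x -> 0 <= sp v w x.
Proof. by move=> r vx; have [|[]] := step_prob_dist r; first by exists x. Qed.

Lemma run_val_ge0 r : run G r -> 0 <= run_val G phi1 phi2 r.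
Proof.
elim=> [|v w x r' IH vx] /=; first exact: ler01.
by rewrite mulr_ge0// step_prob_ge0.
Qed.

Local Open Scope ereal_scope.

(** Restricting the sum to successors gives a dead end the expectation 0, whatever values an
    unconstrained strategy takes there. *)
Definition expect v w (f : node -> \bar R) :=
  \esum_(x in succ G v) ((sp v w x)%:E * f x).

Lemma expect_cst v w (c : R) : run G (v :: w) -> succ G v !=set0 -> (0 <= c)%R ->
  expect v w (cst c%:E) = c%:E.
Proof.
move=> r vx c0; have [ds sup] := step_prob_dist r vx; rewrite /expect.
under eq_esum do rewrite muleC.
rewrite ge0_esumZl// ?(is_dist_esum ds)// ?mule1// => x vx'.
by rewrite lee_fin step_prob_ge0.
Qed.

Lemma le_expect v w f g : run G (v :: w) ->
  (forall x, succ G v x -> f x <= g x) -> expect v w f <= expect v w g.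
Proof.
move=> r fg; apply: le_esum => x vx; rewrite lee_wpmul2l ?fg//.
by rewrite lee_fin step_prob_ge0.
Qed.

Lemma expect_ge0 v w f : run G (v :: w) ->
  (forall x, succ G v x -> 0 <= f x) -> 0 <= expect v w f.
Proof.
move=> r f0; apply: esum_ge0 => x vx.
by rewrite mule_ge0 ?f0// lee_fin step_prob_ge0.
Qed.

(** The bounds on [c] rule out the infinities and cover dead ends, where the expectation is 0. *)
Lemma expect_le v w f c : run G (v :: w) -> 0 <= c <= 1 ->
  (forall x, succ G v x -> f x <= c) -> expect v w f <= c.
Proof.
case: c => [c| |] r /andP[c0 c1] fc //.
have [vx|] := pselect (succ G v !=set0).
  by rewrite -[leRHS](expect_cst r vx)//; exact: le_expect.
by move/nonemptyPn => e; rewrite /expect e esum_set0.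
Qed.

Lemma expect_ge v w f c : run G (v :: w) -> 0 <= c <= 1 -> succ G v !=set0 ->
  (forall x, succ G v x -> c <= f x) -> c <= expect v w f.
Proof.
case: c => [c| |] r /andP[c0 c1] vx fc //.
by rewrite -[leLHS](expect_cst r vx)//; exact: le_expect.
Qed.

Lemma expect_dirac i v w x f : owns i v -> edge G v x -> 0 <= f x ->
  pchoose phi1 phi2 i (v :: w) = dirac_fun x -> expect v w f = f x.
Proof.
move=> iv vx fx phix; rewrite /expect (step_prob_owned w iv) phix.
by rewrite esum_dirac_fun// (succ_edge _ iv).
Qed.

(** * Probability of meeting the target within finitely many steps *)

Variable T : set T1.

(** Conditional probability, given the history [v :: w], of being in [T] now or entering it within
    [n] more steps. *)
Fixpoint hit n v w : \bar R :=
  if `[< in_target T v >] then 1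
  else if n is n'.+1 then expect v w (fun x => hit n' x (v :: w)) else 0.

Lemma hit_ge0 n v w : run G (v :: w) -> 0 <= hit n v w.
Proof.
elim: n v w => [|n IH] v w r /=; case: asboolP => // _.
by apply: expect_ge0 => // x vx; apply: IH; exact: run_step.
Qed.

Definition first_hit_ext n r : set (seq node) :=
  [set r' | first_hit G T r' /\ exists u, r' = u ++ r /\ (size u <= n)%N].

(** Induction on [n]: as long as [T] is not met, the first-hit extensions are partitioned by the
    next node [x], and the value of a run is multiplicative along steps. *)
Lemma esum_first_hit_ext n v w : run G (v :: w) ->
  (forall y, y \in w -> ~ in_target T y) ->
  \esum_(r in first_hit_ext n (v :: w)) (run_val G phi1 phi2 r)%:E =
  (run_val G phi1 phi2 (v :: w))%:E * hit n v w.
Proof.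
elim: n v w => [|n IH] v w r wT.
- rewrite [hit _ _ _]/=; case: asboolP => vT.
    rewrite mule1 -[RHS](@esum_set1 _ _ _ (fun r => (run_val G phi1 phi2 r)%:E))
      ?lee_fin ?run_val_ge0//.
    congr esum; apply/seteqP; split=> [_ [_ [[|a u] [-> le]]]//|_ ->].
    by split; [split => //; exists v, w|exists [::]].
  rewrite mule0 -[RHS](esum_set0 (fun r => (run_val G phi1 phi2 r)%:E)).
  congr esum; apply/seteqP; split=> [r' [fr' [[|a u] [r'E le]]]|]//.
  by case: fr' => _ [x [w' []]]; rewrite r'E => -[<- _].
rewrite [hit _ _ _]/=; case: asboolP => vT.
  rewrite mule1 -[RHS](@esum_set1 _ _ _ (fun r => (run_val G phi1 phi2 r)%:E))
    ?lee_fin ?run_val_ge0//.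
  congr esum; apply/seteqP; split=> [r' [fr' [[|a u] [r'E _]]]//|_ ->].
    (* A proper extension would have the target node [v] strictly before its end, so it is not a
       first hit. *)
    case: fr' => _ [x [w' []]]; rewrite r'E => -[_ <-] _ /(_ v).
    by rewrite mem_cat mem_head orbT => /(_ isT).
  by split; [split => //; exists v, w|exists [::]].
transitivity (\esum_(x in succ G v)
    \esum_(r in first_hit_ext n (x :: v :: w)) (run_val G phi1 phi2 r)%:E).
  (* The double sum is indexed by pairs (next node, run); projecting to the run is a bijection. *)
  rewrite esum_esum; last by move=> x r' _ [[rr' _] _]; rewrite lee_fin run_val_ge0.
  rewrite (reindex_esum (succ G v `*`` (fun x => first_hit_ext n (x :: v :: w))) _
    (@snd node (seq node)))//.
  split=> [[x r'] [/= vx [fr' [u [r'E un]]]]| [x1 r1] [x2 r2] | r' [fr' [u [r'E un]]]].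
  - split=> //; exists (rcons u x); rewrite cat_rcons size_rcons; split => //.
  (* Equal runs have prefixes of equal length, so the next node can be read off. *)
  - rewrite !inE/= => -[_ [_ [u1 [-> _]]]] [_ [_ [u2 [-> _]]]] E.
    congr (_, _) => //; move/(congr1 (drop (size u1))): (E).
    have us : size u1 = size u2.
      by move/(congr1 size): E; rewrite !size_cat/= => /addIn.
    by rewrite drop_size_cat// us drop_size_cat// => -[].
  (* An empty extension would end in [v], which is not in the target; otherwise the last entry of
     [u] is the next node. *)
  - case/lastP: u r'E un => [|u x] r'E un.
      by case: fr' => _ [x [w' []]]; rewrite r'E => -[<- _].
    rewrite cat_rcons in r'E; rewrite size_rcons in un.
    exists (x, r') => //; split; last by split => //; exists u.
    case: fr'; rewrite r'E => /run_cat rx _.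
    by inversion rx.
rewrite -ge0_esumZl ?run_val_ge0//; last first.
  move=> x vx; rewrite mule_ge0 ?lee_fin ?step_prob_ge0// hit_ge0//.
  exact: run_step.
apply: eq_esum => x vx; rewrite IH; last 2 first.
- exact: run_step.
- by move=> y; rewrite in_cons => /orP[/eqP ->//|]; exact: wT.
by rewrite muleA -EFinM.
Qed.

Lemma hit_le_reach n : hit n (N1 (s0 G)) [::] <= reach G phi1 phi2 T.
Proof.
rewrite -[leLHS]mul1e -(@esum_first_hit_ext n (N1 (s0 G)) [::])//; last exact: run_init.
apply: le_esum_subset => [r []//|r [rr _]].
by rewrite lee_fin run_val_ge0.
Qed.

(** A finite partial sum of [reach] involves runs of bounded length, all counted by a single
    [hit N]. Together with [hit_le_reach] this identifies [reach] with the supremum of the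
    [hit n]. *)
Lemma reach_le c : (forall n, hit n (N1 (s0 G)) [::] <= c) ->
  reach G phi1 phi2 T <= c.
Proof.
move=> hc; apply: ge_ereal_sup => _ [X [finX XT] <-].
have [N XN] : exists N, forall r, X r -> (size r <= N)%N.
  move/finite_seqP: finX => [s ->].
  exists (\max_(r <- s) size r) => r rs; exact: leq_bigmax_seq.
apply: le_trans (hc N).
rewrite -[leRHS]mul1e -(@esum_first_hit_ext N (N1 (s0 G)) [::])//; last exact: run_init.
apply: ereal_sup_ubound; exists X => //; split => // r Xr.
split; first exact: XT.
have [rr _] := XT _ Xr; have [u rE] := run_last rr; exists u; split => //.
by have := XN r Xr; rewrite rE size_cat addn1 => /ltnW.
Qed.

End StrategyPair.

(** The axiom of choice assembles choices of edges, one for each history, into a deterministic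
    strategy. *)
Lemma pick_strategy i (Q : seq node -> node -> Prop) :
  (forall v w, run G (v :: w) -> owns i v -> (exists x, edge G v x) ->
     exists x, edge G v x /\ Q (v :: w) x) ->
  exists2 phi, strategies G i phi &
    forall v w, run G (v :: w) -> owns i v -> (exists x, edge G v x) ->
      exists x, [/\ edge G v x, Q (v :: w) x & phi (v :: w) = dirac_fun x].
Proof.
move=> H; have /choice[c cP] : forall r : seq node, exists x,
    forall v w, r = v :: w -> run G r -> owns i v -> (exists y, edge G v y) ->
      edge G v x /\ Q r x.
  move=> [|v w]; first by exists (N1 (s0 G)).
  have [[x [? ?]]|none] := pselect (exists x, edge G v x /\ Q (v :: w) x).
    by exists x => v' w' [<- _].
  (* Dummy value: without a suitable edge the history is outside the domain of a strategy of [i]. *)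
  exists (N1 (s0 G)) => v' w' [<- _] r iv ex.
  by case: none; exact: H.
exists (fun r => dirac_fun (c r)) => v w r iv ex.
  split; first exact: is_dist_dirac_fun.
  by move=> x /dirac_fun_gt0 ->; have [] := cP _ _ _ erefl r iv ex.
by exists (c (v :: w)); have [] := cP _ _ _ erefl r iv ex.
Qed.

End Runs.

(** * Value iteration *)

Section ValueIteration.
Variables (R : realType) (T1 T2 Tp : Type) (G : game R T1 T2 Tp) (T : set T1).
Notation node := (node T1 T2 Tp).
Implicit Types (v x : node) (w : seq node) (m : player -> bool).
Local Open Scope ereal_scope.

(* Dead ends get the value 0, whereas [ereal_sup set0 = -oo] and
   [ereal_inf set0 = +oo]. *)
Definition opt (b : bool) (S : set node) (f : node -> \bar R) : \bar R :=
  if `[< S !=set0 >] then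
    if b then ereal_sup [set f x | x in S] else ereal_inf [set f x | x in S]
  else 0.

(* [m i = true] when player [i] maximizes. *)
Fixpoint value m n v : \bar R :=
  if `[< in_target T v >] then 1 else
  if n is n'.+1 then
    match v with
    | N1 _ => opt (m P1) (edge G v) (value m n')
    | N2 _ => opt (m P2) (edge G v) (value m n')
    | Np u => \esum_(x in succ G v) ((delta G u x)%:E * value m n' x)
    end
  else 0.

(** This is the limit of the iterates, which are nondecreasing by [value_nd]. *)
Definition value_lim m v := ereal_sup (range (fun n => value m n v)).

Lemma value_target m n v : in_target T v -> value m n v = 1.
Proof. by case: n => [|n] vT /=; case: asboolP. Qed.

Lemma valueS_owned m n i v : owns i v -> ~ in_target T v ->
  value m n.+1 v = opt (m i) (edge G v) (value m n).
Proof. by case: i v => -[a|a|a]//= _ vT; case: asboolP. Qed.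

Lemma valueS_prob m n u : value m n.+1 (Np u) =
  \esum_(x in succ G (Np u)) ((delta G u x)%:E * value m n x).
Proof. by rewrite /=; case: asboolP. Qed.

Lemma opt_ge0 b S f : (forall x, S x -> 0 <= f x) -> 0 <= opt b S f.
Proof.
move=> f0; rewrite /opt; case: asboolP => // -[x Sx]; case: b.
  by apply: le_trans (f0 x Sx) _; apply: ereal_sup_ubound; exists x.
by apply: le_ereal_inf_tmp => _ [y Sy <-]; exact: f0.
Qed.

Lemma le_opt b S f g : (forall x, S x -> f x <= g x) -> opt b S f <= opt b S g.
Proof.
move=> fg; rewrite /opt; case: asboolP => // _; case: b.
  apply: ge_ereal_sup => _ [x Sx <-]; apply: le_trans (fg x Sx) _.
  by apply: ereal_sup_ubound; exists x.
apply: le_ereal_inf_tmp => _ [x Sx <-]; apply: le_trans (fg x Sx).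
by apply: ereal_inf_lbound; exists x.
Qed.

Lemma opt_le b S f c : 0 <= c -> (forall x, S x -> f x <= c) -> opt b S f <= c.
Proof.
move=> c0 fc; rewrite /opt; case: asboolP => // -[x Sx]; case: b.
  by apply: ge_ereal_sup => _ [y Sy <-]; exact: fc.
by apply: le_trans (fc x Sx); apply: ereal_inf_lbound; exists x.
Qed.

Lemma value_ge0 m n v : 0 <= value m n v.
Proof.
elim: n v => [|n IH] v; first by rewrite /=; case: asboolP.
have [vT|vT] := pselect (in_target T v); first by rewrite value_target.
have [[i iv]|[u ->]] := owned_or_prob v.
  by rewrite (valueS_owned _ _ iv)//; exact: opt_ge0.
rewrite valueS_prob; apply: esum_ge0 => x ux.
by rewrite mule_ge0 ?IH// lee_fin ltW.
Qed.

(** Membership of [v] matters at probabilistic nodes: [delta G u] is known to have mass 1 only for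
    [u] in [Vp]. *)
Lemma value_le1 m n v : in_nodes (V1 G) (V2 G) (Vp G) v -> value m n v <= 1.
Proof.
elim: n v => [|n IH] v Vv; first by rewrite /=; case: asboolP.
have [vT|vT] := pselect (in_target T v); first by rewrite value_target.
have [[i iv]|[u vE]] := owned_or_prob v.
  rewrite (valueS_owned _ _ iv)//; apply: opt_le => // x vx; apply: IH.
  by have [] := edge_nodes vx.
move: Vv; rewrite {}vE valueS_prob => Vu; have [ds _] := delta_dist Vu.
rewrite -[leRHS](is_dist_esum (S := succ G (Np u)) ds)//.
apply: le_esum => x ux; rewrite -[leRHS]mule1 lee_wpmul2l ?lee_fin ?(ltW ux)//.
by apply: IH; exact: succ_in_nodes ux.
Qed.

Lemma value_nd m v : nondecreasing_seq (fun n => value m n v).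
Proof.
apply/nondecreasing_seqP => n; elim: n v => [|n IH] v.
  rewrite [leLHS]/=; case: asboolP => vT; last exact: value_ge0.
  by rewrite value_target.
have [vT|vT] := pselect (in_target T v); first by rewrite !value_target.
have [[i iv]|[u ->]] := owned_or_prob v.
  by rewrite !(valueS_owned _ _ iv)//; exact: le_opt.
rewrite !valueS_prob; apply: le_esum => x ux.
by rewrite lee_wpmul2l ?IH// lee_fin ltW.
Qed.

Lemma value_le_lim m n v : value m n v <= value_lim m v.
Proof. by apply: ereal_sup_ubound; exists n. Qed.

Lemma value_lim_ge0 m v : 0 <= value_lim m v.
Proof. exact: le_trans (value_ge0 m 0 v) (value_le_lim m 0 v). Qed.

Lemma value_lim_01 m v : in_nodes (V1 G) (V2 G) (Vp G) v -> 0 <= value_lim m v <= 1.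
Proof.
move=> Vv; rewrite value_lim_ge0.
by apply: ge_ereal_sup => _ [n _ <-]; exact: value_le1.
Qed.

Lemma max_value_edge m i n v x : m i -> owns i v -> ~ in_target T v ->
  edge G v x -> value m n x <= value m n.+1 v.
Proof.
move=> mi iv vT vx; rewrite (valueS_owned _ _ iv)// mi /opt.
case: asboolP => [_|[]]; last by exists x.
by apply: ereal_sup_ubound; exists x.
Qed.

Lemma max_value_le m i n v c : m i -> owns i v -> ~ in_target T v -> 0 <= c ->
  (forall x, edge G v x -> value m n x <= c) -> value m n.+1 v <= c.
Proof. by move=> mi iv vT c0 H; rewrite (valueS_owned _ _ iv)//; exact: opt_le. Qed.

Lemma min_value_edge m i n v x : ~~ m i -> owns i v -> ~ in_target T v ->
  edge G v x -> value m n.+1 v <= value m n x.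
Proof.
move=> /negbTE mi iv vT vx; rewrite (valueS_owned _ _ iv)// mi /opt.
case: asboolP => [_|[]]; last by exists x.
by apply: ereal_inf_lbound; exists x.
Qed.

Lemma min_value_ge m i n v c : ~~ m i -> owns i v -> ~ in_target T v ->
  (exists x, edge G v x) -> (forall x, edge G v x -> c <= value m n x) ->
  c <= value m n.+1 v.
Proof.
move=> /negbTE mi iv vT ex H; rewrite (valueS_owned _ _ iv)// mi /opt.
case: asboolP => // _.
by apply: le_ereal_inf_tmp => _ [x vx <-]; exact: H.
Qed.

(** Nodes outside [succ] have weight 0, so the sum extends to all nodes and [esum_finsupp]
    applies. *)
Lemma value_prob_sum m n u k (p : 'I_k -> R) (q : 'I_k -> node) :
  (forall i, (0 <= p i)%R) ->
  (forall x, delta G u x = (\sum_(i < k | `[< q i = x >]) p i)%R) ->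
  value m n.+1 (Np u) = \sum_(i < k) (p i)%:E * value m n (q i).
Proof.
move=> p0 dE; rewrite valueS_prob -esum_finsupp => [||x]//; last exact: value_ge0.
rewrite esum_mkcond; apply: eq_esum => x _; rewrite -dE.
case: ifPn => // /negP ux.
suff -> : delta G u x = 0%R by rewrite mul0e.
apply/eqP; rewrite eq_le {2}dE sumr_ge0// andbT leNgt; apply/negP => dx.
by apply: ux; rewrite inE.
Qed.

(** * Optimal replies under finite branching *)

Hypothesis finite_branching : forall i v, owns i v -> finite_set (edge G v).

(** The premise [~~ m i] makes the condition vacuous for a maximizer, so that one statement serves
    all four combinations of objectives. *)
Definition min_reply m i (phi : seq node -> node -> R) :=
  ~~ m i -> forall v w, run G (v :: w) -> owns i v -> ~ in_target T v ->
    (exists x, edge G v x) ->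
  exists x, [/\ edge G v x, value_lim m x <= value_lim m v &
                phi (v :: w) = dirac_fun x].

(** [N] is the total horizon: [size w] steps have been made and [n.+1] remain, so the stage is
    determined by the length of the history. *)
Definition max_reply m N i (phi : seq node -> node -> R) :=
  m i -> forall v w n, (n.+1 + size w = N)%N -> run G (v :: w) -> owns i v ->
    ~ in_target T v -> (exists x, edge G v x) ->
  exists x, [/\ edge G v x, value m n.+1 v <= value m n x & phi (v :: w) = dirac_fun x].

(* Over a finite set of successors, some successor is minimal for infinitely
   many [n], so it stays below the limit value of [v]. *)
Lemma exists_min_reply m i : exists2 phi, strategies G i phi & min_reply m i phi.
Proof.
pose Q r x := if r is v :: _ then ~~ m i -> ~ in_target T v ->
  value_lim m x <= value_lim m v else True.
have [|phi Sphi H] := @pick_strategy _ _ _ _ G i Q.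
  move=> v w r iv [y vy].
  case: (boolP (m i)) => mi; first by exists y; split=> //; rewrite /Q mi.
  have [vT|vT] := pselect (in_target T v); first by exists y; split=> // ? [].
  have [|||x vx xle] := @finite_uniform_bound _ _ (edge G v)
    (fun n => value m n) (value_lim m v).
  - exact: finite_branching iv.
  - exact: value_nd.
  - move=> n; apply: contrapT => none.
    have : value_lim m v < value m n.+1 v.
      rewrite (valueS_owned _ _ iv)// (negbTE mi) /opt.
      case: asboolP => [ne|[]]; last by exists y.
      (* Negation turns the maximum into a minimum. As it is attained, the infimum over the edges
         stays strictly above the limit. *)
      have [x vx xmin] := @finite_arg_max _ _ _ (fun x => - value m n x)
        (finite_branching iv) ne.
      have /lt_le_trans : value_lim m v < value m n x.
        by rewrite ltNge; apply/negP => le; apply: none; exists x.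
      apply; apply: le_ereal_inf_tmp => _ [z vz <-].
      by rewrite -leeN2 xmin.
    by rewrite ltNge value_le_lim.
  exists x; split=> // _ _.
  by apply: ge_ereal_sup => _ [n _ <-]; exact: xle.
exists phi => // mi v w r iv vT ex.
by have [x [vx Qx phix]] := H _ _ r iv ex; exists x; split=> //; exact: Qx.
Qed.

Lemma exists_max_reply m N i : exists2 phi, strategies G i phi & max_reply m N i phi.
Proof.
pose Q r x := if r is v :: w then m i -> ~ in_target T v ->
  forall n, (n.+1 + size w = N)%N -> value m n.+1 v <= value m n x else True.
have [|phi Sphi H] := @pick_strategy _ _ _ _ G i Q.
  move=> v w r iv [y vy].
  (* The index is the [n] with [n.+1 + size w = N]. *)
  have [x vx xmax] := @finite_arg_max _ _ _ (value m (N - (size w).+1)%N)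
    (finite_branching iv) (ex_intro _ y vy).
  exists x; split=> // mi vT n nN.
  rewrite -nN addSnnS addnK in xmax.
  exact: (max_value_le mi iv vT (value_ge0 _ _ _) xmax).
exists phi => // mi v w n nN r iv vT ex.
by have [x [vx Qx phix]] := H _ _ r iv ex; exists x; split=> //; exact: Qx.
Qed.

(** The expectation of [value_lim] after one step never exceeds its present value: no move of a
    maximizer raises it, a minimizer's reply does not either, and monotone convergence handles
    probabilistic nodes. Hence it bounds every [hit n]. *)
Lemma reach_le_value_lim m phi1 phi2 :
  strategies G P1 phi1 -> strategies G P2 phi2 ->
  min_reply m P1 phi1 -> min_reply m P2 phi2 ->
  reach G phi1 phi2 T <= value_lim m (N1 (s0 G)).
Proof.
move=> S1 S2 M1 M2; apply: reach_le => // n.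
have Mi i : min_reply m i (pchoose phi1 phi2 i) by case: i.
have: run G [:: N1 (s0 G)] by exact: run_init.
elim: n (N1 _) [::] => [|n IH] v w r /=; case: asboolP => vT.
- by rewrite -(value_target m 0 vT) value_le_lim.
- exact: value_lim_ge0.
- by rewrite -(value_target m 0 vT) value_le_lim.
apply: le_trans (_ : expect G phi1 phi2 v w (value_lim m) <= _).
  apply: le_expect => // x vx; apply: IH; exact: run_step.
have Vv := run_in_nodes r.
have [[i iv]|[u vE]] := owned_or_prob v.
  case: (boolP (m i)) => mi.
    apply: expect_le (value_lim_01 m Vv) _ => // x; rewrite (succ_edge _ _ iv) => vx.
    apply: ge_ereal_sup => _ [k _ <-].
    exact: le_trans (max_value_edge k mi iv vT vx) (value_le_lim _ _ _).
  have [ex|nex] := pselect (exists x, edge G v x).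
    have [x [vx xle phix]] := Mi i mi v w r iv vT ex.
    by rewrite (expect_dirac iv vx (value_lim_ge0 _ _) phix).
  rewrite /expect (_ : succ G v = set0) ?esum_set0 ?value_lim_ge0//.
  apply/seteqP; split=> // x; rewrite (succ_edge _ _ iv) => vx.
  by apply: nex; exists x.
rewrite vE; apply: esum_monotone_convergence_le => [x|k x|x|k] /=.
- exact: ltW.
- exact: value_ge0.
- exact: value_nd.
- by rewrite -valueS_prob value_le_lim.
Qed.

(** Finite-horizon dual of [reach_le_value_lim]: minimizers play arbitrarily, maximizers reply
    optimally, and [hit] dominates the iterate with the same number of remaining stages. *)
Lemma value_le_reach m N phi1 phi2 :
  strategies G P1 phi1 -> strategies G P2 phi2 ->
  max_reply m N P1 phi1 -> max_reply m N P2 phi2 ->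
  value m N (N1 (s0 G)) <= reach G phi1 phi2 T.
Proof.
move=> S1 S2 M1 M2; apply: le_trans (hit_le_reach S1 S2 T N).
have Mi i : max_reply m N i (pchoose phi1 phi2 i) by case: i.
have: run G [:: N1 (s0 G)] by exact: run_init.
have: (N + size (Nil node) = N)%N by rewrite addn0.
(* The horizon on the right of the equation stays fixed while the remaining stages decrease and the
   history grows. *)
elim: {1 3 4}N (N1 _) [::] => [|n IH] v w nN r.
  by rewrite /=; case: asboolP.
have [vT|vT] := pselect (in_target T v).
  by rewrite value_target//=; case: asboolP.
rewrite [leRHS]/=; case: asboolP => // _.
apply: le_trans (_ : _ <= expect G phi1 phi2 v w (value m n)) _; last first.
  apply: le_expect => // x vx; apply: IH; last exact: run_step.
  by rewrite /= addnS -addSn.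
have Vv := run_in_nodes r.
have [[i iv]|[u vE]] := owned_or_prob v; last first.
  by rewrite vE valueS_prob.
have [ex|nex] := pselect (exists x, edge G v x); last first.
  have E0 : 0 <= expect G phi1 phi2 v w (value m n).
    by apply: expect_ge0 => // x _; exact: value_ge0.
  apply: le_trans E0.
  by rewrite (valueS_owned _ _ iv)// /opt; case: asboolP.
case: (boolP (m i)) => mi.
  have [x [vx xle phix]] := Mi i mi v w n nN r iv vT ex.
  by rewrite (expect_dirac iv vx (value_ge0 _ _ _) phix).
apply: expect_ge => //.
- by rewrite value_ge0 value_le1.
- by case: ex => x vx; exists x; rewrite (succ_edge _ _ iv).
- move=> x; rewrite (succ_edge _ _ iv) => vx.
  exact: (min_value_edge n mi iv vT vx).
Qed.

(** * Extremal values of a game against limits of iterates *)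

Lemma reach_mm_le_value_lim :
  reach_mm G T <= value_lim (pchoose false false) (N1 (s0 G)).
Proof.
have [phi1 S1 M1] := exists_min_reply (pchoose false false) P1.
have [phi2 S2 M2] := exists_min_reply (pchoose false false) P2.
apply: le_trans (reach_le_value_lim S1 S2 M1 M2).
apply: le_trans
  (_ : ereal_inf [set reach G phi1 phi2 T | phi2 in strategies G P2] <= _).
  by apply: ereal_inf_lbound; exists phi1.
by apply: ereal_inf_lbound; exists phi2.
Qed.

(** Against any [phi1] of the minimizing Player 1, a reply of Player 2 for horizon [n] secures the
    [n]-th iterate. *)
Lemma value_lim_le_reach_mp :
  value_lim (pchoose false true) (N1 (s0 G)) <= reach_mp G T.
Proof.
apply: le_ereal_inf_tmp => _ [phi1 S1 <-]; apply: ge_ereal_sup => _ [n _ <-].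
have [phi2 S2 M2] := exists_max_reply (pchoose false true) n P2.
apply: le_trans (value_le_reach S1 S2 _ M2) _ => //.
by apply: ereal_sup_ubound; exists phi2.
Qed.

(** A single reply of Player 2 keeps every [phi1] below the limit. *)
Lemma reach_pm_le_value_lim :
  reach_pm G T <= value_lim (pchoose true false) (N1 (s0 G)).
Proof.
apply: ge_ereal_sup => _ [phi1 S1 <-].
have [phi2 S2 M2] := exists_min_reply (pchoose true false) P2.
apply: le_trans (reach_le_value_lim S1 S2 _ M2) => //.
by apply: ereal_inf_lbound; exists phi2.
Qed.

Lemma value_lim_le_reach_pp :
  value_lim (pchoose true true) (N1 (s0 G)) <= reach_pp G T.
Proof.
apply: ge_ereal_sup => _ [n _ <-].
have [phi1 S1 M1] := exists_max_reply (pchoose true true) n P1.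
have [phi2 S2 M2] := exists_max_reply (pchoose true true) n P2.
apply: le_trans (value_le_reach S1 S2 M1 M2) _.
apply: le_trans
  (_ : _ <= ereal_sup [set reach G phi1 phi2 T | phi2 in strategies G P2]) _.
  by apply: ereal_sup_ubound; exists phi2.
by apply: ereal_sup_ubound; exists phi1.
Qed.

End ValueIteration.

(** * Value iteration for Markov decision processes *)

Section MDPValue.
Variables (R : realType) (T1 Tp : Type) (M : mdp R T1 Tp) (T : set T1).
Hypothesis finite_branching :
  forall i (v : node T1 void Tp), owns i v -> finite_set (edge M v).
Local Open Scope ereal_scope.

Lemma mdp_strategy2 phi : strategies M P2 phi.
Proof. by case=> [?|[]|?]. Qed.

(** Any strategy stays below the limit, and replies for growing horizons approach it. *)
Lemma mdp_reach_pE : mdp_reach_p M T = value_lim M T (fun=> true) (N1 (s0 M)).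
Proof.
apply/eqP; rewrite eq_le; apply/andP; split.
  apply: ge_ereal_sup => _ [phi S1 <-].
  by apply: reach_le_value_lim S1 _ _ _ => //; exact: mdp_strategy2.
apply: ge_ereal_sup => _ [n _ <-].
have [phi S1 M1] := exists_max_reply T finite_branching (fun=> true) n P1.
apply: le_trans (_ : _ <= mdp_reach M phi T) _.
  apply: value_le_reach S1 _ M1 _; first exact: mdp_strategy2.
  by move=> _ [?|[]|?].
by apply: ereal_sup_ubound; exists phi.
Qed.

(** Any strategy reaches at least every iterate, and a minimizing reply does not exceed the
    limit. *)
Lemma mdp_reach_mE : mdp_reach_m M T = value_lim M T (fun=> false) (N1 (s0 M)).
Proof.
apply/eqP; rewrite eq_le; apply/andP; split; last first.
  apply: le_ereal_inf_tmp => _ [phi S1 <-]; apply: ge_ereal_sup => _ [n _ <-].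
  by apply: value_le_reach S1 _ _ _ => //; exact: mdp_strategy2.
have [phi S1 M1] := exists_min_reply T finite_branching (fun=> false) P1.
apply: le_trans (_ : mdp_reach M phi T <= _).
  by apply: ereal_inf_lbound; exists phi.
apply: reach_le_value_lim S1 _ M1 _; first exact: mdp_strategy2.
by move=> _ [?|[]|?].
Qed.

End MDPValue.

(** * Comparison of the iterates *)

Section Abstraction.
Variables (R : realType) (P : npp R) (F : set (config P)).
Variables (disp : Order.disp_t) (D : porderType disp).
Variables (alpha : set (config P) -> D) (gamma : D -> set (config P)).
Variable G : abs_game P D.
Hypothesis live : forall sigma : config P, reachable sigma -> ~ F sigma ->
  exists A : cmd P, guard A sigma.
Hypothesis Gvalid : valid_abstraction F alpha gamma G.
Notation M := (prog_mdp P).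
Implicit Types (s t : D) (sigma : config P) (A : cmd P) (m : player -> bool).

(** There may be infinitely many configurations, but successors are indexed by the finite type of
    commands. *)
Lemma prog_finite_branching i v : owns i v -> finite_set (edge M v).
Proof.
case: i v => -[sigma|[]|u]// _.
apply: sub_finite_set (_ : finite_set [set Np (sigma, A) | A in [set: cmd P]]).
  by move=> _ [_ [A [[<-] -> _]]]; exists A.
exact: finite_image.
Qed.

Lemma abs_finite_branching i v : owns i v -> finite_set (edge G v).
Proof.
move=> _; have [f1 f2 fp] := va_finite Gvalid.
apply: sub_finite_set
  (_ : finite_set (N1 @` V1 G `|` N2 @` V2 G `|` Np @` Vp G)).
  move=> x /edge_nodes[_ _]; case: x => y Vy; [left; left|left; right|right];
  by exists y.
by rewrite !finite_setU; do ?split; exact: finite_image.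
Qed.

(** Keeps [live] applicable along the inductions below. *)
Lemma reachable_asgn sigma A (i : 'I_(arity A)) :
  reachable sigma -> guard A sigma -> 0 < prob i -> reachable (asgn i sigma).
Proof.
move=> [w r] gA pi; exists [:: Np (sigma, A), N1 sigma & w].
apply: run_step; first by apply: run_step r _; exists sigma, A.
rewrite /= (bigD1 i) /=; last exact/asboolP.
by rewrite ltr_pwDl// sumr_ge0// => j _; exact: prob_ge0.
Qed.

Lemma prog_value_prob (T : set _) m n sigma A :
  value M T m n.+1 (Np (sigma, A)) =
  (\sum_(i < arity A) (prob i)%:E * value M T m n (N1 (asgn i sigma)))%E.
Proof.
apply: value_prob_sum => [i|x]; first exact: prob_ge0.
case: x => [sigma'|[]|u] /=; last by rewrite big_pred0// => i; exact/asboolP.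
by apply: eq_bigl => i; apply/asboolP/asboolP => [->|[]].
Qed.

(** [va_3] gives [delta] only at nodes of [V1]. The image of [prob] under [d] agrees with it there
    and is 0 elsewhere, hence lies below it; equal masses then force equality. *)
Lemma abs_value_prob (T : set _) m n s A t (d : 'I_(arity A) -> D) :
  Vp G (Absp s A t d) ->
  value G T m n.+1 (Np (Absp s A t d)) =
  (\sum_(i < arity A) (prob i)%:E * value G T m n (N1 (Abs (d i))))%E.
Proof.
move=> Vu; apply: value_prob_sum => [i|x]; first exact: prob_ge0.
have [_ _ _ _ Vd] := va_Vp Gvalid Vu; have [[d0 d1] _] := delta_dist Vu.
pose q : 'I_(arity A) -> node (abs1 D) (abs2 P D) (absp P D) := fun i => N1 (Abs (d i)).
suff /is_dist_eq H y : \sum_(i < arity A | `[< q i = y >]) prob i <=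
    delta G (Absp s A t d) y.
  apply/esym/H => //; apply: is_dist_finsupp => [i|]; first exact: prob_ge0.
  exact: prob_sum1.
have [V1y|nV1y] := pselect (exists2 a, V1 G a & y = N1 a).
  case: V1y => a V1a ->; rewrite (va_3 Gvalid)// le_eqVlt; apply/orP; left.
  by apply/eqP/eq_bigl => i; apply/asboolP/asboolP => [[->]|<-].
rewrite big_pred0// => i; apply/asboolP => qy; apply: nV1y.
by exists (Abs (d i)) => //; have [] := Vd i.
Qed.

(** Restricting to positive weights matches [reachable_asgn], which gives reachability for such
    updates only. *)
Lemma le_prob_sum A (a b : 'I_(arity A) -> \bar R) :
  (forall i, 0 < prob i -> (a i <= b i)%E) ->
  (\sum_(i < arity A) (prob i)%:E * a i <= \sum_(i < arity A) (prob i)%:E * b i)%E.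
Proof.
move=> ab; apply: lee_sum => i _.
have := prob_ge0 i; rewrite le_eqVlt => /orP[/eqP <-|pi]; first by rewrite !mul0e.
by rewrite lee_wpmul2l ?ab// lee_fin ltW.
Qed.

(** The Player 2 move that imitates a concrete step: some member of the cover in [va_2a] contains
    [sigma], and soundness of [d] carries each update along. *)
Lemma abs_cover s sigma A : V2 G (s, Some A) -> gamma s sigma -> guard A sigma ->
  exists t (d : 'I_(arity A) -> D),
    [/\ Vp G (Absp s A t d), edge G (N2 (s, Some A)) (Np (Absp s A t d)) &
        forall i, V1 G (Abs (d i)) /\ gamma (d i) (asgn i sigma)].
Proof.
move=> V2s sS gA; have [k [t [d [H cover]]]] := va_2a Gvalid V2s.
have [j _ tj] := cover sigma (conj sS gA); have [Vj ej] := H j.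
exists (t j), (d j); split=> // i; have [_ _ _ _ /(_ i)[? sub]] := va_Vp Gvalid Vj.
by split=> //; apply: sub; exists sigma.
Qed.

Lemma V2_edge s o : edge G (N1 (Abs s)) (N2 (s, o)) -> V2 G (s, o).
Proof. by case/edge_nodes. Qed.

(** Two stages suffice: every move of Player 1 leads to some [(s, o)] from which Player 2 can move
    to [Accept], so the objective of Player 1 is immaterial. *)
Lemma value_final (T : set _) m n s sigma : V1 G (Abs s) -> gamma s sigma -> F sigma ->
  (forall s', ~ T (Abs s')) -> T Accept -> m P2 ->
  value G T m n.+2 (N1 (Abs s)) = 1%E.
Proof.
move=> Vs sS Fs TA Tacc m2.
have nT : ~ in_target T (N1 (Abs s) : node (abs1 D) (abs2 P D) (absp P D)).
  exact: TA.
have sF : gamma s `&` F !=set0 by exists sigma.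
have [e1 e2 _ _] := va_1a Gvalid Vs sF.
have ge1 o : edge G (N1 (Abs s)) (N2 (s, o)) ->
    (1 <= value G T m n.+1 (N2 (s, o)))%E.
  move=> so; have acc : edge G (N2 (s, o)) (N1 Accept).
    by case: o so => // A /V2_edge sA; exact: (va_2b Gvalid).
  by rewrite -(@value_target _ _ _ _ G T m n (N1 Accept))//;
     exact: (max_value_edge (i := P2) n m2 _ _ acc).
apply/eqP; rewrite eq_le value_le1// andTb.
case: (boolP (m P1)) => m1.
  by apply: le_trans (ge1 _ e1) _; exact: (max_value_edge (i := P1) _ m1 _ nT e1).
apply: (@min_value_ge _ _ _ _ _ _ _ P1) => //; [by exists (N2 (s, None))|].
by move=> x sx; case: (va_edge1 Gvalid sx) => [[A E]|[E _]]; subst x; exact: ge1.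
Qed.

Lemma not_sub_final s sigma : gamma s sigma -> ~ F sigma -> ~ (gamma s `<=` F).
Proof. by move=> sS nF sub; apply: nF; exact: sub. Qed.

(** Both abstract players minimize, so they can imitate any concrete command and its cover. *)
Lemma abs_mm_le n s sigma : V1 G (Abs s) -> gamma s sigma -> reachable sigma ->
  (value G [set Accept; Reject] (pchoose false false) n (N1 (Abs s)) <=
   value M F (fun=> false) n.*2 (N1 sigma))%E.
Proof.
elim: n s sigma => [|n IH] s sigma Vs sS rs.
  by rewrite [leLHS]/=; case: asboolP => [[]//|_]; exact: value_ge0.
have [Fs|nF] := pselect (F sigma).
  by rewrite [leRHS]value_target//; exact: value_le1.
rewrite doubleS; apply: (@min_value_ge _ _ _ _ _ _ _ P1) => //.
  (* A dead end would have value 0 and break the lower bound. *)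
  by have [A gA] := live rs nF; exists (Np (sigma, A)), sigma, A.
move=> _ [_ [A [[<-] -> gA]]].
have [|V2s eA] := va_1b Gvalid Vs (not_sub_final sS nF) (A := A).
  by exists sigma.
have [t [d [Vu eu dP]]] := abs_cover V2s sS gA.
rewrite prog_value_prob; apply: (@le_trans _ _
  (\sum_(i < arity A) (prob i)%:E *
     value G [set Accept; Reject] (pchoose false false) n (N1 (Abs (d i))))%E).
  rewrite -(abs_value_prob _ _ _ Vu).
  (* Two extra stages make room for the three moves of an abstract round. *)
  apply: le_trans (value_nd _ _ _ _ (leqW (leqnSn n.+1))) _.
  apply: le_trans (min_value_edge (i := P1) _ _ _ _ eA) _ => //; first by case.
  exact: (min_value_edge (i := P2) _ _ _ _ eu).
apply: le_prob_sum => i pi; have [Vd gd] := dP i.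
by apply: IH => //; exact: reachable_asgn.
Qed.

(** Whatever Player 1 selects, Player 2 has an answer: [Accept] after [(s, None)], [Reject] (here a
    target) after a command disabled in [sigma], imitation otherwise. The stage counts three moves
    per round plus the two of [value_final]. *)
Lemma mdp_le_abs_mp n s sigma : V1 G (Abs s) -> gamma s sigma -> reachable sigma ->
  (value M F (fun=> false) n.*2 (N1 sigma) <=
   value G [set Accept; Reject] (pchoose false true) (n * 3).+2 (N1 (Abs s)))%E.
Proof.
elim: n s sigma => [|n IH] s sigma Vs sS rs.
  have [Fs|nF] := pselect (F sigma); last first.
    by rewrite [leLHS]/=; case: asboolP => // _; exact: value_ge0.
  by rewrite value_target// (value_final _ Vs sS Fs)//; [by move=> ? []|by left].
have [Fs|nF] := pselect (F sigma).
  by rewrite value_target// (value_final _ Vs sS Fs)//; [by move=> ? []|by left].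
have nsub := not_sub_final sS nF.
rewrite mulSn; apply: (@min_value_ge _ _ _ _ _ _ _ P1) => //; first by case.
  have [A gA] := live rs nF; have [|_ eA] := va_1b Gvalid Vs nsub (A := A).
    by exists sigma.
  by exists (N2 (s, Some A)).
move=> x sx; case: (va_edge1 Gvalid sx) => [[A E]|[E sF]]; subst x; last first.
  have [_ e2 _ _] := va_1a Gvalid Vs sF.
  apply: le_trans (max_value_edge (i := P2) _ _ _ _ e2) => //.
  by rewrite (@value_target _ _ _ _ _ _ _ _ (N1 Accept)) ?value_le1//; left.
have V2s := V2_edge sx.
have [gA|ngA] := pselect (guard A sigma); last first.
  (* [sigma] itself witnesses that the guard does not cover [gamma s]. *)
  have e2 : edge G (N2 (s, Some A)) (N1 Reject).
    apply: (va_2c Gvalid) V2s _ => E; apply: ngA.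
    by have [] : (gamma s `&` guard A) sigma by rewrite E.
  apply: le_trans (max_value_edge (i := P2) _ _ _ _ e2) => //.
  by rewrite (@value_target _ _ _ _ _ _ _ _ (N1 Reject)) ?value_le1//; right.
have [t [d [Vu eu dP]]] := abs_cover V2s sS gA.
apply: le_trans (max_value_edge (i := P2) _ _ _ _ eu) => //.
rewrite doubleS (abs_value_prob _ _ _ Vu).
apply: (@le_trans _ _ (value M F (fun=> false) n.*2.+1 (Np (sigma, A)))).
  by apply: (min_value_edge (i := P1)) => //; exists sigma, A.
rewrite prog_value_prob; apply: le_prob_sum => i pi; have [Vd gd] := dP i.
by apply: IH => //; exact: reachable_asgn.
Qed.

(** At a non-final [sigma], Player 2 minimizes by looping at [(s, None)], moving to [Reject] (here
    not a target) after a disabled command, and imitating an enabled one. *)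
Lemma abs_pm_le n s sigma : V1 G (Abs s) -> gamma s sigma ->
  (value G [set Accept] (pchoose true false) n (N1 (Abs s)) <=
   value M F (fun=> true) n.*2 (N1 sigma))%E.
Proof.
elim: n s sigma => [|n IH] s sigma Vs sS.
  by rewrite [leLHS]/=; case: asboolP => [[]//|_]; exact: value_ge0.
have [Fs|nF] := pselect (F sigma).
  by rewrite [leRHS]value_target//; exact: value_le1.
have nsub := not_sub_final sS nF.
apply: (@max_value_le _ _ _ _ _ _ _ P1) => //; first exact: value_ge0.
move=> x sx; case: (va_edge1 Gvalid sx) => [[A E]|[E sF]]; subst x; last first.
  have [_ _ _ /(_ nsub) loop] := va_1a Gvalid Vs sF.
  apply: (@le_trans _ _ 0%E); last exact: value_ge0.
  (* The loop passes the value 0 of stage 0 on to every stage. *)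
  elim: n {IH} => [|n IHn]; first by rewrite /=; case: asboolP.
  by apply: le_trans IHn; exact: (min_value_edge (i := P2)) loop.
have V2s := V2_edge sx.
have [gA|ngA] := pselect (guard A sigma); last first.
  have e2 : edge G (N2 (s, Some A)) (N1 Reject).
    apply: (va_2c Gvalid) V2s _ => E; apply: ngA.
    by have [] : (gamma s `&` guard A) sigma by rewrite E.
  apply: le_trans (value_nd _ _ _ _ (leqnSn n)) _.
  apply: le_trans (min_value_edge (i := P2) _ _ _ _ e2) _ => //.
  apply: (@le_trans _ _ 0%E); last exact: value_ge0.
  (* [Reject] is a dead end outside the target, hence of value 0. *)
  case: n {IH} => [|n]; first by rewrite /=; case: asboolP.
  apply: (@max_value_le _ _ _ _ _ _ _ P1) => // x rx.
  by have [_ []] := va_4 Gvalid x.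
have [t [d [Vu eu dP]]] := abs_cover V2s sS gA.
apply: le_trans (value_nd _ _ _ _ (leqW (leqnSn n))) _.
apply: le_trans (min_value_edge (i := P2) _ _ _ _ eu) _ => //.
rewrite doubleS (abs_value_prob _ _ _ Vu).
apply: (@le_trans _ _ (value M F (fun=> true) n.*2.+1 (Np (sigma, A)))).
  rewrite prog_value_prob; apply: le_prob_sum => i pi; have [Vd gd] := dP i.
  exact: IH.
by apply: (max_value_edge (i := P1)) => //; exists sigma, A.
Qed.

(** Both abstract players maximize, so imitating the concrete command is available to them. *)
Lemma mdp_le_abs_pp n s sigma : V1 G (Abs s) -> gamma s sigma ->
  (value M F (fun=> true) n.*2 (N1 sigma) <=
   value G [set Accept] (pchoose true true) (n * 3).+2 (N1 (Abs s)))%E.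
Proof.
elim: n s sigma => [|n IH] s sigma Vs sS.
  have [Fs|nF] := pselect (F sigma); last first.
    by rewrite [leLHS]/=; case: asboolP => // _; exact: value_ge0.
  by rewrite value_target// (value_final _ Vs sS Fs).
have [Fs|nF] := pselect (F sigma).
  by rewrite value_target// (value_final _ Vs sS Fs).
rewrite doubleS mulSn; apply: (@max_value_le _ _ _ _ _ _ _ P1) => //.
  exact: value_ge0.
move=> _ [_ [A [[<-] -> gA]]].
have [|V2s eA] := va_1b Gvalid Vs (not_sub_final sS nF) (A := A).
  by exists sigma.
have [t [d [Vu eu dP]]] := abs_cover V2s sS gA.
apply: le_trans (max_value_edge (i := P1) _ _ _ _ eA) => //.
apply: le_trans (max_value_edge (i := P2) _ _ _ _ eu) => //.
rewrite (abs_value_prob _ _ _ Vu) prog_value_prob.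
by apply: le_prob_sum => i pi; have [Vd gd] := dP i; exact: IH.
Qed.

End Abstraction.

Theorem theorem2 (R : realType) (P : npp R) (F : set (config P))
    (disp : Order.disp_t) (D : porderType disp)
    (alpha : set (config P) -> D) (gamma : D -> set (config P))
    (G : abs_game P D)
    (init_notF : ~ F (@init R P))
    (live : forall sigma : config P, reachable sigma -> ~ F sigma ->
              exists A : cmd P, guard A sigma)
    (Dcomplete : complete_lattice D)
    (Dgalois : galois_connection alpha gamma)
    (Gvalid : valid_abstraction F alpha gamma G) :
  (reach_mm G [set Accept; Reject] <= mdp_reach_m (prog_mdp P) F
     <= reach_mp G [set Accept; Reject])%E /\
  (reach_pm G [set Accept] <= mdp_reach_p (prog_mdp P) F
     <= reach_pp G [set Accept])%E.
Proof.
have fM := @prog_finite_branching R P; have fG := abs_finite_branching Gvalid.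
have s0E := va_s0 Gvalid; have Vs := s0_V1 G; rewrite s0E in Vs.
(* The unit of the Galois connection starts the comparisons at the initial configuration. *)
have sS : gamma (alpha [set @init R P]) (@init R P).
  by have [/(_ (lexx _)) sub _] :=
    alpha_gamma Dgalois [set @init R P] (alpha [set @init R P]); exact: sub.
have rs : reachable (@init R P) by exists [::]; exact: run_init.
(* The comparisons treat even stages of the program MDP; monotonicity of the iterates reduces every
   stage to these. *)
have dbl n : (n <= n.*2)%N by rewrite -addnn leq_addr.
rewrite mdp_reach_mE// mdp_reach_pE//; split; apply/andP; split.
- apply: le_trans (reach_mm_le_value_lim _ fG) _; rewrite s0E.
  apply: ge_ereal_sup => _ [n _ <-].
  by apply: le_trans (value_le_lim _ _ _ n.*2 _); exact: (abs_mm_le live Gvalid).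
- apply: le_trans (value_lim_le_reach_mp _ fG); rewrite s0E.
  apply: ge_ereal_sup => _ [n _ <-].
  apply: le_trans (value_le_lim _ _ _ (n * 3).+2 _).
  apply: le_trans (value_nd _ _ _ _ (dbl n)) _; exact: (mdp_le_abs_mp live Gvalid).
- apply: le_trans (reach_pm_le_value_lim _ fG) _; rewrite s0E.
  apply: ge_ereal_sup => _ [n _ <-].
  by apply: le_trans (value_le_lim _ _ _ n.*2 _); exact: (abs_pm_le Gvalid).
- apply: le_trans (value_lim_le_reach_pp _ fG); rewrite s0E.
  apply: ge_ereal_sup => _ [n _ <-].
  apply: le_trans (value_le_lim _ _ _ (n * 3).+2 _).
  apply: le_trans (value_nd _ _ _ _ (dbl n)) _; exact: (mdp_le_abs_pp Gvalid).
Qed.
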